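(* Let $C$ be a caterpillar whose spine has order $s$. Then $C$ is $\max\!\left(0,\left\lfloor \frac{s-1}{2}\right\rfloor-1-\mathcal{E}(C)\right)$-antimagic.
   Context: All graphs are finite, simple and connected. For a graph $G$ and vertex $v$, $E(v)$ is the set of edges incident to $v$ and $d(v)=|E(v)|$. For an integer $k\ge 0$, a $k$-antimagic labeling of $G$ is an injection $f:E(G)\to\{1,2,\dots,|E(G)|+k\}$ such that the vertex sums $\sum_{e\in E(v)} f(e)$, $v\in V(G)$, are pairwise distinct; $G$ is $k$-antimagic if it has such a labeling, and antimagic if it is $0$-antimagic. A caterpillar is a tree of order at least $3$ such that removing all its leaves yields a path, called its spine; the order of the spine is its number of vertices. The leaves excess of a caterpillar $C$ is $\mathcal{E}(C)=\sum_{v\in V(C),\, d(v)\ge 4}(d(v)-3)$. *)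

(* Defs.v *)
From mathcomp Require Import all_boot.

Set Implicit Arguments.
Unset Strict Implicit.
Unset Printing Implicit Defensive.

Record sgraph := SGraph {
  vertex :> finType;
  adj : rel vertex;
  adj_sym : symmetric adj;
  adj_irrefl : irreflexive adj
}.

Section Graph.
Variable G : sgraph.

Definition edges : {set {set G}} :=
  [set [set x.1; x.2] | x : G * G & adj x.1 x.2].

Definition incident (v : G) : {set {set G}} := [set a in edges | v \in a].

Definition degree (v : G) : nat := #|incident v|.

Definition vertex_sum (f : {set G} -> nat) (v : G) : nat :=
  \sum_(a in incident v) f a.

(* Labels are given to all sets of vertices, but only the values on edges
   matter. *)
Definition antimagic_labeling (k : nat) (f : {set G} -> nat) : Prop :=
  [/\ {in edges &, injective f},
      {in edges, forall a, 1 <= f a <= #|edges| + k} &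
      injective (vertex_sum f)].

Definition antimagic (k : nat) : Prop := exists f, antimagic_labeling k f.

Definition connected : Prop := forall x y : G, connect (@adj G) x y.

(* [ucycle] also accepts the empty sequence and, for an edge xy, the closed
   walk x, y, x; cycles of the graph are those with at least 3 vertices. *)
Definition acyclic : Prop := forall c : seq G, ucycle (@adj G) c -> size c < 3.

Definition tree : Prop := connected /\ acyclic.

Definition leaf (v : G) : bool := degree v == 1.

Definition spine : {set G} := [set v | ~~ leaf v].

(* The subgraph induced by S is isomorphic to a path on n + 1 vertices. *)
Definition induces_path (S : {set G}) : Prop :=
  exists (n : nat) (h : 'I_n.+1 -> G),
    [/\ injective h, [set h i | i : 'I_n.+1] = S &
        forall i j : 'I_n.+1,
          adj (h i) (h j) = (i.+1 == j :> nat) || (j.+1 == i :> nat)].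

Definition caterpillar : Prop := [/\ tree, 3 <= #|G| & induces_path spine].

Definition leaves_excess : nat := \sum_(v : G | 4 <= degree v) (degree v - 3).

End Graph.

(* Main.v *)
Require Import Defs.
From mathcomp Require Import all_boot.
From mathcomp Require Import zify.

(* List the edges of a longest path as e_0, ..., e_s and label e_j by
   floor(j/2) + 1 when j + s is even, by c + floor(j/2) + 1 when j + s is odd.
   The two path edges at the i-th spine vertex then sum to c + 1 + i, so spine
   vertices of degree 2 have sums in [c + 2, c + 1 + s]. The s/2 + 1 small labels
   and the large ones leave an interval ending at c for the pendant edges off the
   path, so leaves have sums at most c + 1. At each spine vertex of degree at
   least 3 set one such edge aside. The remaining ones, as many as the leaves
   excess, take the smallest labels of the interval; the next k labels are
   skipped; the edges set aside take the last labels, in increasing order of the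
   partial sums at their spine vertices, which keeps these sums distinct. The
   bound on k says precisely that the labels set aside are at least s, which
   pushes the sums at vertices of degree at least 3 above c + 1 + s. *)

Set Implicit Arguments.
Unset Strict Implicit.
Unset Printing Implicit Defensive.

(** The rank is the position in [A] sorted by [P]; ties are broken arbitrarily, so the comparison of
    weights is only weak. *)
Lemma monotone_rank (T : finType) (A : {set T}) (P : T -> nat) :
  exists r : T -> nat,
    [/\ {in A &, injective r}, {in A, forall x, r x < #|A|} &
        {in A &, forall x y, r x < r y -> P x <= P y}].
Proof.
pose l := sort (relpre P leq) (enum A).
have ml x : (x \in l) = (x \in A) by rewrite mem_sort mem_enum.
exists (index^~ l); split=> [x y xA yA|x xA|x y xA yA /ltnW].
- by apply: (index_inj x); rewrite ?inE ml.
- by rewrite cardE -(size_sort (relpre P leq)) index_mem ml.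
- apply: (sorted_leq_index (leT := relpre P leq)); rewrite ?ml //.
  + by move=> u v w; apply: leq_trans.
  + by move=> u /=.
  + by apply: sort_sorted => u v; apply: leq_total.
Qed.

(** * Edge labelings of a rooted tree as vertex labelings *)

(* Each edge of the tree rooted at [root] is encoded by its endpoint [x] away from
   the root; [ht] excludes [par (par x) = x]. *)
Section ParentFunction.

Variables (G : sgraph) (root : G) (par : G -> G) (ht : G -> nat).
Hypothesis adj_par : forall x, x != root -> adj x (par x).
Hypothesis ht_par : forall x, x != root -> ht x < ht (par x).
Hypothesis par_adj : forall x y, adj x y ->
  (x != root) && (par x == y) || (y != root) && (par y == x).

Lemma edges_parent : edges G = [set [set x; par x] | x in [set~ root]].
Proof.
apply/setP=> a; apply/imsetP/imsetP => [[[x y]]|[x]].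
- rewrite inE /= => xy ->.
  case/orP: (par_adj xy) => /andP[xr /eqP <-] /=.
    by exists x; rewrite ?inE.
  by exists y; rewrite ?inE // setUC.
- by rewrite in_setC1 => xr ->; exists (x, par x); rewrite ?inE /= ?adj_par.
Qed.

(** Distinct vertices with the same edge would be each other's parents, and [ht] would increase both
    ways. *)
Lemma parent_edge_inj :
  {in [set~ root] &, injective (fun x => [set x; par x])}.
Proof.
move=> x y; rewrite !in_setC1 => xr yr /= exy.
have: x \in [set y; par y] by rewrite -exy set21.
have: y \in [set x; par x] by rewrite exy set21.
rewrite !inE => /orP[/eqP -> //|/eqP yx] /orP[/eqP -> //|/eqP xy].
by have := ht_par xr; have := ht_par yr; rewrite -yx -xy; lia.
Qed.

Lemma card_edges_parent : #|edges G| = #|G|.-1.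
Proof.
by rewrite edges_parent card_in_imset ?cardsC1 //; exact: parent_edge_inj.
Qed.

(** An edge at [v] leads either to its parent, which the root lacks, or to a child. *)
Lemma vertex_sum_parent (f : {set G} -> nat) (g : G -> nat) v :
  (forall x, x != root -> f [set x; par x] = g x) ->
  vertex_sum f v =
    (if v == root then 0 else g v) +
      \sum_(x | (x != root) && (par x == v)) g x.
Proof.
move=> fg; rewrite /vertex_sum /incident edges_parent.
transitivity (\sum_(a in [set [set x; par x] | x in [set~ root]] | v \in a) f a).
  by apply: eq_bigl => a; rewrite inE.
rewrite big_mkcondr big_imset /=; last exact: parent_edge_inj.
rewrite -big_mkcondr (bigID (pred1 v)) /=; congr (_ + _).
- case: eqP => [->|/eqP vr].
    rewrite big_pred0 // => x; rewrite !inE.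
    by case: (eqVneq x root) => //= _; rewrite andbF.
  rewrite (big_pred1 v) ?fg // => x; rewrite !inE.
  by case: (eqVneq x v) => [->|]; rewrite ?vr ?eqxx ?andbF.
- apply: eq_big => [x|x]; rewrite !inE.
    case: (eqVneq x root) => //= xr; rewrite eq_sym [v == par x]eq_sym.
    case: (eqVneq x v) => [<-|xv]; rewrite ?andbT ?andbF //.
    by apply/esym/eqP => h; have := ht_par xr; rewrite h ltnn.
  by case/andP=> /andP[xr _] _; rewrite fg.
Qed.

Lemma degree_parent v :
  degree v = (v != root) + #|[set x | (x != root) && (par x == v)]|.
Proof.
rewrite /degree -sum1_card.
rewrite [LHS](@vertex_sum_parent (fun=> 1) (fun=> 1) v) //.
rewrite sum1_card; congr (_ + _); first by case: eqP.
by apply: eq_card => x; rewrite !inE.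
Qed.

Lemma antimagic_parent k (g : G -> nat) :
  {in [set~ root] &, injective g} ->
  (forall x, x != root -> 1 <= g x <= #|G|.-1 + k) ->
  injective (fun v => (if v == root then 0 else g v) +
                      \sum_(x | (x != root) && (par x == v)) g x) ->
  antimagic G k.
Proof.
move=> ginj gb sinj.
(* An edge determines its endpoint away from the root, whose label it takes; 0 is a default off the
   edges. *)
pose f (a : {set G}) :=
  if [pick x | (x != root) && ([set x; par x] == a)] is Some x then g x else 0.
have fg x : x != root -> f [set x; par x] = g x.
  move=> xr; rewrite /f; case: pickP => [y /andP[yr /eqP e]|/(_ x)].
    by congr g; apply: parent_edge_inj; rewrite ?in_setC1.
  by rewrite xr eqxx.
exists f; split.
- move=> a b; rewrite edges_parent.
  move=> /imsetP[x xr ->] /imsetP[y yr ->].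
  by move: (xr) (yr); rewrite !in_setC1 => xr' yr'; rewrite !fg // => /ginj ->.
- move=> a; rewrite card_edges_parent edges_parent => /imsetP[x].
  by rewrite in_setC1 => xr ->; rewrite fg ?gb.
- by move=> u v; rewrite !(vertex_sum_parent _ fg); apply: sinj.
Qed.

End ParentFunction.

(** * Caterpillars as a longest path with pendant leaves *)

Section LongestPath.

(* The vertices of a longest path are listed in [w], from the leaf [nth root w 0]
   to the leaf [root]; every other vertex is a leaf attached to the spine. *)
Variables (G : sgraph) (root : G) (par : G -> G) (w : seq G) (s : nat).
Hypothesis s_gt0 : 0 < s.
Hypothesis uniq_w : uniq w.
Hypothesis size_w : size w = s.+2.
Hypothesis root_w : nth root w s.+1 = root.
Hypothesis par_w : forall i, i <= s -> par (nth root w i) = nth root w i.+1.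
Hypothesis par_leaf : forall x, x \notin w -> 0 < index (par x) w <= s.
Hypothesis adj_par : forall x, x != root -> adj x (par x).
Hypothesis par_adj : forall x y, adj x y ->
  (x != root) && (par x == y) || (y != root) && (par y == x).

(** Vertices off the path get 0, below every path vertex, so that [ht] also increases from them to
    their parents. *)
Let ht (x : G) := if x \in w then (index x w).+1 else 0.
Let kids v := [set x | (x \notin w) && (par x == v)].

Lemma index_w i : i <= s.+1 -> index (nth root w i) w = i.
Proof. by move=> le_is; rewrite index_uniq ?size_w. Qed.

Lemma mem_w i : i <= s.+1 -> nth root w i \in w.
Proof. by move=> le_is; rewrite mem_nth ?size_w. Qed.

Lemma index_root : index root w = s.+1.
Proof. by rewrite -{1}root_w index_w. Qed.

Lemma rootP x : (x == root) = (index x w == s.+1).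
Proof.
apply/eqP/eqP=> [->|e]; first exact: index_root.
by rewrite -root_w -e nth_index // -index_mem e size_w.
Qed.

Lemma w_cases x :
  x \notin w \/ exists2 i, i <= s.+1 & x = nth root w i.
Proof.
case: (boolP (x \in w)) => xw; [right|by left].
by exists (index x w); rewrite ?nth_index //; move: xw; rewrite -index_mem size_w.
Qed.

Lemma ht_par x : x != root -> ht x < ht (par x).
Proof.
rewrite rootP /ht; case: (w_cases x) => [xw _|[i le_is ->]].
  have := par_leaf xw; rewrite (negPf xw) -[par x \in w]index_mem size_w.
  by case: ifP => //; lia.
rewrite index_w // => neq_is; have lt_is : i <= s by lia.
by rewrite par_w // !mem_w ?index_w //; lia.
Qed.

Lemma child_w x i : i <= s.+1 ->
  (x != root) && (par x == nth root w i) =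
    (x \in kids (nth root w i)) || (0 < i) && (x == nth root w i.-1).
Proof.
move=> le_is; rewrite inE; case: (w_cases x) => [xw|[j le_js ->]].
  have -> : x != root by rewrite -{1}root_w; apply: contraNneq xw => ->;
    rewrite mem_w.
  rewrite xw /=; case: (x =P nth root w i.-1) => [xi|_]; last by rewrite andbF orbF.
  by case/negP: xw; rewrite xi mem_w //; lia.
rewrite mem_w // rootP index_w //=; case: (eqVneq j s.+1) => [->|neq_js] /=.
  by rewrite nth_uniq ?size_w; lia.
rewrite par_w ?nth_uniq ?size_w //; lia.
Qed.

Lemma sum_children (g : G -> nat) i : i <= s.+1 ->
  \sum_(x | (x != root) && (par x == nth root w i)) g x =
    (if 0 < i then g (nth root w i.-1) else 0) +
      \sum_(x in kids (nth root w i)) g x.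
Proof.
move=> le_is; under eq_bigl do rewrite child_w //.
have nk : nth root w i.-1 \notin kids (nth root w i).
  by rewrite inE negb_and negbK mem_w //; lia.
case: i le_is nk => [|i] le_is nk /=.
  by apply: eq_bigl => x; rewrite orbF.
rewrite (bigD1 (nth root w i)) ?eqxx ?orbT //=; congr (_ + _).
apply: eq_bigl => x; case: eqP => [->|]; rewrite ?orbF ?andbT //=.
by rewrite (negPf nk).
Qed.

Lemma kids_end i : (i == 0) || (i == s.+1) -> kids (nth root w i) = set0.
Proof.
move=> ei; apply/setP=> x; rewrite !inE; apply/negP=> /andP[xw /eqP e].
by have := par_leaf xw; rewrite e index_w; lia.
Qed.

Lemma sum_children_leaf (g : G -> nat) v : v \notin w ->
  \sum_(x | (x != root) && (par x == v)) g x = 0.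
Proof.
move=> vw; rewrite big_pred0 // => x; apply/negP=> /andP[xr /eqP xv].
case: (w_cases x) => [xw|[i le_is xi]].
  by have := par_leaf xw; rewrite xv memNindex // size_w; lia.
move: xr; rewrite rootP xi index_w // => ne.
by move: vw; rewrite -xv xi par_w ?mem_w //; lia.
Qed.

Lemma degree_w v : degree v = if 0 < index v w <= s then #|kids v|.+2 else 1.
Proof.
rewrite (degree_parent adj_par ht_par par_adj) -sum1_card.
under eq_bigl do rewrite inE.
case: (w_cases v) => [vw|[i le_is ->]].
  rewrite sum_children_leaf // rootP memNindex // size_w.
  by case: ifP; lia.
rewrite sum_children // rootP index_w // sum1_card.
case: (boolP ((i == 0) || (i == s.+1))) => [ei|nei].
  rewrite kids_end // cards0.
  by case/orP: ei => /eqP ->; rewrite ?ltnn ?andbF ?eqxx.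
have [-> ->] : 0 < i <= s /\ 0 < i by lia.
by have -> : i == s.+1 = false by lia.
Qed.

(** * Extra leaves and the leaves excess *)

(* At every spine vertex of degree at least 3, one extra leaf is set aside;
   [spare] collects the extra leaves that are not set aside. *)
Let extra : {set G} := [set x | x \notin w].
Let spare : {set G} := [set x in extra | [pick y in kids (par x)] != Some x].
Let aside : {set G} := extra :\: spare.

Lemma in_aside x :
  (x \in aside) = (x \notin w) && ([pick y in kids (par x)] == Some x).
Proof.
by rewrite /aside /spare !inE; case: (x \notin w); rewrite ?andbF //= andbT negbK.
Qed.

Lemma kids_aside v : kids v != set0 ->
  exists2 y, y \in aside & par y = v /\ kids v = y |: (kids v :&: spare).
Proof.
move=> /set0Pn[z zv]; case E: [pick y in kids v] => [y|]; last first.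
  by move: E; case: pickP => // /(_ z); rewrite zv.
have yv : y \in kids v by move: E; case: pickP => // t tv [<-].
move: (yv); rewrite inE => /andP[yw /eqP yp].
exists y; first by rewrite in_aside yw yp E eqxx.
split=> //; apply/setP=> x; rewrite !inE.
case: (eqVneq x y) => [->|xy]; first by rewrite yw yp eqxx.
case: eqP => [->|]; rewrite ?andbF // andbT E.
have -> : Some y != Some x by apply/eqP=> -[e]; rewrite e eqxx in xy.
by rewrite andbT andbb.
Qed.

Lemma aside_spare v y : y \in aside -> y \notin kids v :&: spare.
Proof. by case/setDP=> _ ys; rewrite in_setI negb_and ys orbT. Qed.

(** A vertex of degree d >= 4 lies on the spine and has d - 2 extra leaves, all but one of them
    spare. *)
Lemma leaves_excess_spare : leaves_excess G <= #|spare|.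
Proof.
rewrite -sum1_card (partition_big par predT) //= /leaves_excess big_mkcond.
apply: leq_sum => v _; case: ifP => // _.
have -> : \sum_(x in spare | par x == v) 1 = #|kids v :&: spare|.
  rewrite -sum1_card; apply: eq_bigl => x; rewrite !inE.
  by case: (x \notin w); rewrite ?andbF //= andbC.
rewrite degree_w; case: ifP => // _.
have [->|/kids_aside[y ya [_ {1}->]]] := eqVneq (kids v) set0.
  by rewrite cards0.
by rewrite cardsU1 aside_spare //; lia.
Qed.

Lemma card_longest_path : #|G| = s.+2 + #|spare| + #|aside|.
Proof.
have cw : #|[set x in w]| = s.+2 by rewrite cardsE -size_w; apply/card_uniqP.
rewrite -(cardsC [set x in w]) cw -addnA; congr (_ + _).
have -> : ~: [set x in w] = extra by apply/setP=> x; rewrite !inE.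
rewrite -(cardsID spare extra); congr (#|pred_of_set _| + _).
by apply/setIidPr/subsetP => x; rewrite inE => /andP[].
Qed.

(** * The labeling and its vertex sums *)

Lemma antimagic_longest_path k :
  (s - 1)./2 - 1 <= k + #|spare| -> antimagic G k.
Proof.
move=> le_k; pose a := s./2.+1.
(* Any order of the spare labels will do, hence the constant weight. *)
have [rs [rs_inj rs_lt _]] := monotone_rank spare (fun=> 0).
pose gs x := a + (rs x).+1.
(* For [x] set aside, [c.+1 + psum x] is the sum at its spine vertex before the label of [x] is
   added. *)
pose psum x := index (par x) w + \sum_(z in kids (par x) :&: spare) gs z.
have [ra [ra_inj ra_lt ra_mono]] := monotone_rank aside psum.
pose ga x := a + #|spare| + k + (ra x).+1.
pose c := a + #|spare| + k + #|aside|.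
(* This labels the edge from the i-th path vertex to the next. The parity of [i + s] makes the last
   edge small, which keeps the sum at [root] low. *)
pose gw i := i./2.+1 + (if odd (i + s) then c else 0).
pose g x := if x \in w then gw (index x w) else if x \in spare then gs x else ga x.
have g_w i : i <= s.+1 -> g (nth root w i) = gw i.
  by move=> le_is; rewrite /g mem_w // index_w.
have g_spare x : x \in spare -> g x = gs x.
  by move=> xs; rewrite /g xs; move: xs; rewrite !inE => /andP[/negPf-> _].
have g_aside x : x \in aside -> g x = ga x.
  rewrite /g {1}/aside inE => /andP[/negPf-> ]; rewrite inE.
  by move=> /negPf->.
have cases x : x != root ->
  [\/ exists2 i, i <= s & x = nth root w i, x \in spare | x \in aside].
  rewrite rootP => xr; case: (w_cases x) => [xw|[i le_is xi]].
    case: (boolP (x \in spare)) => xs; first by apply: Or32.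
    by apply: Or33; rewrite inE xs inE.
  apply: Or31; exists i => //; move: xr; rewrite xi index_w //; lia.
have g_inj : {in [set~ root] &, injective g}.
  move=> x y; rewrite !in_setC1.
  move=> /cases[[i le_i ->]|xs|xa] /cases[[j le_j ->]|ys|ya].
  - rewrite !g_w ?leqW // /gw => e; congr (nth root w _).
    move: e; rewrite /c /a; case: ifP; case: ifP; lia.
  - rewrite g_w ?leqW // g_spare // /gw /gs /c.
    have := rs_lt _ ys; case: ifP; lia.
  - rewrite g_w ?leqW // g_aside // /gw /ga /c.
    have := ra_lt _ ya; case: ifP; lia.
  - rewrite g_w ?leqW // g_spare // /gw /gs /c.
    have := rs_lt _ xs; case: ifP; lia.
  - rewrite !g_spare // /gs => e; apply: rs_inj => //; lia.
  - rewrite g_spare // g_aside // /gs /ga; have := rs_lt _ xs; lia.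
  - rewrite g_w ?leqW // g_aside // /gw /ga /c.
    have := ra_lt _ xa; case: ifP; lia.
  - rewrite (g_spare y) // g_aside // /gs /ga; have := rs_lt _ ys; lia.
  - rewrite !g_aside // /ga => e; apply: ra_inj => //; lia.
apply: (antimagic_parent adj_par ht_par par_adj g_inj) => [x /cases|].
  have -> : #|G|.-1 = s.+1 + #|spare| + #|aside| by rewrite card_longest_path.
  case=> [[i le_i ->]|xs|xa].
  - by rewrite (g_w i (leqW le_i)) /gw /c /a; case: ifP; lia.
  - by rewrite g_spare // /gs /a; have := rs_lt _ xs; lia.
  - by rewrite g_aside // /ga /a; have := ra_lt _ xa; lia.
set S := fun v => _.
pose inner v := 0 < index v w <= s.
(* [sg v] encodes the only edge at a leaf [v]; that of the root is encoded by its predecessor on the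
   path. *)
pose sg v := if v == root then nth root w s else v.
have sg_root v : sg v != root.
  by rewrite /sg; case: ifP => [_|-> //]; rewrite rootP index_w //; lia.
have S_outer v : ~~ inner v -> S v = g (sg v).
  rewrite /inner /S /sg; case: (w_cases v) => [vw _|[i le_is ->]].
    rewrite sum_children_leaf // addn0 rootP memNindex // size_w.
    by case: eqP => //; lia.
  rewrite index_w // => oi; rewrite sum_children // kids_end; last by lia.
  rewrite big_set0 addn0 rootP index_w //.
  by case: eqP => [->|neq_is]; [|case: ifP => ?; [lia|rewrite addn0]].
have S_outer_le v : ~~ inner v -> S v <= c.+1.
  move=> ov; rewrite S_outer //; case: (cases _ (sg_root v)) => [[i le_i]|xs|xa].
  (* A path edge at a leaf is the first, labeled 1 or c + 1, or the last, labeled a. *)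
  - move=> ei; have {le_i} : i = 0 \/ i = s.
      move: ei ov; rewrite /sg /inner rootP; case: eqP => [_|ne] e.
        by move/eqP: e; rewrite nth_uniq ?size_w //; lia.
      by rewrite e index_w; lia.
    by rewrite ei; case=> ->; rewrite g_w // /gw /c /a; case: ifP; lia.
  - by rewrite g_spare // /gs /c; have := rs_lt _ xs; lia.
  - by rewrite g_aside // /ga /c; have := ra_lt _ xa; lia.
have S_inner v : inner v ->
    S v = c.+1 + index v w + \sum_(x in kids v) g x.
  rewrite /inner /S; case: (w_cases v) => [vw|[i le_is ->]].
    by rewrite memNindex // size_w; lia.
  rewrite index_w // => i_in; rewrite sum_children // rootP index_w //.
  rewrite addnA; congr (_ + _); have -> : 0 < i by lia.
  have -> : i == s.+1 = false by lia.
  rewrite !g_w /gw; [case: ifP; case: ifP; lia|lia|lia].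
have S_aside v : inner v -> kids v != set0 ->
    exists2 y, y \in aside & par y = v /\ S v = c.+1 + psum y + ga y.
  move=> iv kv; have [y ya [yv ek]] := kids_aside kv.
  exists y => //; split=> //; rewrite S_inner // ek big_setU1 ?aside_spare //=.
  rewrite g_aside // (eq_bigr gs) => [|z]; last by case/setIP=> _ /g_spare.
  by rewrite /psum yv; lia.
have S_aside_gt v : inner v -> kids v != set0 -> c.+1 + s < S v.
  move=> iv kv; have [y _ [yv ->]] := S_aside _ iv kv.
  (* The index in [psum y] is at least 1, and [ga y] is at least s by the bound on k. *)
  by move: iv; rewrite /psum /ga yv /inner /a; lia.
have S_plain v : inner v -> kids v = set0 -> S v = c.+1 + index v w.
  by move=> iv kv; rewrite S_inner // kv big_set0 addn0.
have S_inner_gt v : inner v -> c.+1 < S v.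
  by move=> iv; rewrite S_inner //; move: iv; rewrite /inner; lia.
(* The threshold c + 1 separates leaves from spine vertices, which settles the mixed cases. *)
move=> u v eS; case: (boolP (inner u)) => iu; case: (boolP (inner v)) => iv;
  last 1 first.
- move: eS iu iv; have := sg_root u; have := sg_root v.
  (* Two leaves: [sg] is injective on them, since the predecessor of the root is a spine vertex. *)
  move=> ru rv eS ou ov; move: eS; rewrite !S_outer // => /g_inj.
  rewrite !in_setC1 => /(_ rv ru); move: ou ov; rewrite /sg /inner.
  case: eqP => [->|_]; case: eqP => [->|_] //.
    by move=> _ ov e; move: ov; rewrite -e index_w; lia.
  by move=> ou _ e; move: ou; rewrite e index_w; lia.
- have [ku|ku] := eqVneq (kids u) set0; have [kv|kv] := eqVneq (kids v) set0.
  + move: eS; rewrite !S_plain // => /addnI.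
    by apply: (index_inj root); move: iu iv; rewrite /inner -!index_mem size_w; lia.
  + have := S_aside_gt _ iv kv; rewrite -eS S_plain //.
    by move: iu; rewrite /inner; lia.
  + have := S_aside_gt _ iu ku; rewrite eS S_plain //.
    by move: iv; rewrite /inner; lia.
  + have [y ya [yu ey]] := S_aside _ iu ku; have [z za [zv ez]] := S_aside _ iv kv.
    rewrite -yu -zv; congr par; apply: ra_inj => //; move: eS; rewrite ey ez /ga.
    (* A smaller rank comes with a partial sum that is no larger, so the totals would differ. *)
    case: (ltngtP (ra y) (ra z)) => // lt_r.
      by have := ra_mono _ _ ya za lt_r; lia.
    by have := ra_mono _ _ za ya lt_r; lia.
- by have := S_inner_gt _ iu; have := S_outer_le _ iv; rewrite eS; lia.
- by have := S_inner_gt _ iv; have := S_outer_le _ iu; rewrite eS; lia.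
Qed.

Lemma antimagic_of_longest_path k :
  (s - 1)./2 - 1 <= k + leaves_excess G -> antimagic G k.
Proof.
move=> le_k; apply: antimagic_longest_path.
by apply: leq_trans le_k _; rewrite leq_add2l leaves_excess_spare.
Qed.

End LongestPath.

(** * Leaves and spine vertices in a connected graph *)

Section Neighbours.

Variable G : sgraph.

Lemma degree_neighbours (v : G) : degree v = #|[set x | adj v x]|.
Proof.
have -> : degree v = #|[set [set v; x] | x in [set x | adj v x]]|.
  congr #|pred_of_set _|; apply/setP=> a; rewrite inE.
  apply/andP/imsetP => [[/imsetP[[x y]]]|[x]].
    rewrite inE /= => xy ->; rewrite !inE => /orP[]/eqP->.
      by exists y; rewrite ?inE.
    by exists x; rewrite ?inE 1?adj_sym // setUC.
  rewrite inE => vx ->; rewrite set21; split=> //.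
  by apply/imsetP; exists (v, x); rewrite ?inE.
rewrite card_in_imset // => x y; rewrite !inE => vx vy e.
have: x \in [set v; y] by rewrite -e set22.
by rewrite !inE => /orP[]/eqP // xv; rewrite xv adj_irrefl in vx.
Qed.

Lemma leaf_neighbour_unique (l x y : G) : leaf l -> adj l x -> adj l y -> x = y.
Proof.
rewrite /leaf degree_neighbours => /cards1P[z /setP lz] lx ly.
by move: (lz x) (lz y); rewrite !inE lx ly => /esym/eqP-> /esym/eqP->.
Qed.

Lemma leaf_has_neighbour (l : G) : leaf l -> exists x, adj l x.
Proof.
rewrite /leaf degree_neighbours => /cards1P[z /setP/(_ z)].
by rewrite !inE eqxx => lz; exists z.
Qed.

(** A nonempty set closed under adjacency is everything; applied to sets of one or two vertices,
    this contradicts order at least 3. *)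
Lemma connected_closed (A : {set G}) (x : G) :
  connected G -> x \in A -> (forall y z, y \in A -> adj y z -> z \in A) ->
  #|G| <= #|A|.
Proof.
move=> conn xA closA; suff -> : A = setT by rewrite cardsT.
apply/setP=> y; rewrite inE; apply/esym.
rewrite -(closed_connect _ (conn x y)) ?xA // => u v uv.
by apply/idP/idP => ?;
  [exact: closA uv | apply: closA (_ : adj v u); rewrite // adj_sym].
Qed.

Lemma leaf_adj_spine (l y : G) :
  connected G -> 3 <= #|G| -> leaf l -> adj l y -> ~~ leaf y.
Proof.
move=> conn ge3 ll ly; apply/negP=> yl.
have yl' : adj y l by rewrite adj_sym.
have: #|G| <= #|[set l; y]|.
  apply: (connected_closed conn (set21 l y)) => u v.
  rewrite inE => /orP[]/set1P-> uv.
    by rewrite (leaf_neighbour_unique ll uv ly) set22.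
  by rewrite (leaf_neighbour_unique yl uv yl') set21.
by move/(leq_trans ge3); rewrite cards2; case: eqP.
Qed.

(** Not being a leaf leaves degree 0 to exclude: an isolated vertex would be the whole graph. *)
Lemma spine_degree_gt1 (v : G) :
  connected G -> 3 <= #|G| -> ~~ leaf v -> 1 < #|[set x | adj v x]|.
Proof.
move=> conn ge3; rewrite /leaf degree_neighbours => d1.
rewrite ltn_neqAle eq_sym d1 lt0n.
apply/negP; rewrite cards_eq0 => /eqP/setP nv.
have: #|G| <= #|[set v]|.
  apply: (connected_closed conn (set11 v)) => y z; rewrite inE => /eqP-> vz.
  by move: (nv z); rewrite !inE vz.
by move/(leq_trans ge3); rewrite cards1.
Qed.

End Neighbours.

(** * From the spine to a longest path *)

Section Spine.

Variables (G : sgraph) (n : nat) (h : 'I_n.+1 -> G).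
Hypothesis conn : connected G.
Hypothesis ge3 : 3 <= #|G|.
Hypothesis h_inj : injective h.
Hypothesis h_spine : [set h i | i : 'I_n.+1] = spine G.
Hypothesis h_adj : forall i j : 'I_n.+1,
  adj (h i) (h j) = (i.+1 == j :> nat) || (j.+1 == i :> nat).

Lemma spineP x : reflect (exists i, x = h i) (~~ leaf x).
Proof.
have -> : ~~ leaf x = (x \in spine G) by rewrite inE.
by rewrite -h_spine; apply: (iffP imsetP) => [[i _ ->]|[i ->]]; exists i.
Qed.

Lemma nonleaf_h i : ~~ leaf (h i).
Proof. by apply/spineP; exists i. Qed.

(** Of at least two neighbours, at most one is on the spine. *)
Lemma end_leaf (i j : 'I_n.+1) :
  (forall k, adj (h i) (h k) -> k = j) -> exists2 l, leaf l & adj l (h i).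
Proof.
move=> ij; have /card_gt1P[x [y [ix iy xy]]] :=
  spine_degree_gt1 conn ge3 (nonleaf_h i).
rewrite !inE in ix iy.
case: (boolP (leaf x)) => [lx|/spineP[k xk]]; first by exists x; rewrite // adj_sym.
case: (boolP (leaf y)) => [ly|/spineP[m ym]]; first by exists y; rewrite // adj_sym.
have kj : k = j by apply: ij; rewrite -xk.
have mj : m = j by apply: ij; rewrite -ym.
by rewrite xk ym kj mj eqxx in xy.
Qed.

Lemma end_leaves : exists l0 l1,
  [/\ leaf l0, leaf l1, l0 != l1, adj l0 (h ord0) & adj l1 (h ord_max)].
Proof.
(* A one-vertex spine is both ends at once and must supply two distinct leaves. *)
case: (posnP n) => [n0|n_gt0].
  have all0 i : i = ord0 :> 'I_n.+1 by apply: val_inj => /=; have := ltn_ord i; lia.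
  have /card_gt1P[x [y [ix iy xy]]] := spine_degree_gt1 conn ge3 (nonleaf_h ord0).
  have lf z : z \in [set x | adj (h ord0) x] -> leaf z /\ adj z (h ord0).
    rewrite inE => hz; split; last by rewrite adj_sym.
    by apply/negPn/negP=> /spineP[i zi]; rewrite zi (all0 i) adj_irrefl in hz.
  have [lx hx] := lf _ ix; have [ly hy] := lf _ iy.
  by exists x, y; rewrite (all0 ord_max).
have [|l0 ll0 hl0] := @end_leaf ord0 (inord 1).
  by move=> k; rewrite h_adj => e; apply: val_inj;
    rewrite /= inordK; move: e => /=; lia.
have [|l1 ll1 hl1] := @end_leaf ord_max (inord n.-1).
  move=> k; rewrite h_adj => e; apply: val_inj; rewrite /= inordK; last by lia.
  by move: e (ltn_ord k) => /=; lia.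
exists l0, l1; split=> //; apply: contraTneq n_gt0 => l01.
rewrite -l01 in hl1.
have /h_inj/(congr1 val) /= := leaf_neighbour_unique ll0 hl0 hl1.
by move=> <-.
Qed.

(** A leaf at each end prolongs the spine to a longest path [w]; the tree is rooted at its last
    vertex [l1]. *)
Lemma antimagic_spine k :
  n./2 - 1 <= k + leaves_excess G -> antimagic G k.
Proof.
move=> le_k; have [l0 [l1 [ll0 ll1 l01 hl0 hl1]]] := end_leaves.
pose hh i := h (inord i).
pose q := mkseq hh n.+1; pose w := l0 :: rcons q l1.
have size_q : size q = n.+1 by rewrite size_mkseq.
have w_h i : i <= n -> nth l1 w i.+1 = hh i.
  move=> le_in; rewrite -[LHS]/(nth l1 (rcons q l1) i).
  by rewrite nth_rcons size_q ltnS le_in nth_mkseq.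
have w_last : nth l1 w n.+2 = l1.
  by rewrite -[LHS]/(nth l1 (rcons q l1) n.+1) nth_rcons size_q ltnn eqxx.
have size_w : size w = n.+3.
  by rewrite -[LHS]/(size (rcons q l1)).+1 size_rcons size_q.
have leaf_hh i : leaf (hh i) = false by apply/negbTE/nonleaf_h.
have hh_notin x : leaf x -> x \notin q.
  by move=> lx; apply/negP=> /mapP[i _ xi]; rewrite xi leaf_hh in lx.
have hh_inj i j : i <= n -> j <= n -> hh i = hh j -> i = j.
  by move=> ? ? /h_inj/(congr1 val) /=; rewrite !inordK.
have uniq_w : uniq w.
  rewrite cons_uniq mem_rcons inE negb_or l01 hh_notin //.
  rewrite rcons_uniq hh_notin // !andTb map_inj_in_uniq ?iota_uniq // => i j; rewrite !mem_iota => ? ?.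
  by apply: hh_inj; lia.
have nonleafP x : ~~ leaf x -> exists2 i, i <= n & x = hh i.
  by case/spineP=> i ->; exists i; [rewrite -ltnS | rewrite /hh inord_val].
have index_h i : i <= n -> index (hh i) w = i.+1.
  by move=> le_in; rewrite -w_h // index_uniq ?size_w //; lia.
(* A leaf points to its only neighbour, a spine vertex to its successor on [w]. The root [l1] is a
   leaf too, but its value is excluded by [x != root]. *)
pose par x := if leaf x then odflt x [pick y | adj x y]
              else nth l1 w (index x w).+1.
have adj_leaf x : leaf x -> adj x (par x).
  move=> lx; rewrite /par lx; case: pickP => //= x0.
  by have [y] := leaf_has_neighbour lx; rewrite x0.
have par_leaf x y : leaf x -> adj x y -> par x = y.
  by move=> lx; apply: leaf_neighbour_unique (adj_leaf _ lx).
have par_h i : i <= n -> par (hh i) = nth l1 w i.+2.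
  by move=> le_in; rewrite /par leaf_hh index_h.
have hh_adj i j : i <= n -> j <= n -> adj (hh i) (hh j) = (i.+1 == j) || (j.+1 == i).
  by move=> ? ?; rewrite h_adj !inordK.
have hh0 : hh 0 = h ord0 by congr h; apply: val_inj; rewrite /= inordK.
have hhn : hh n = h ord_max by congr h; apply: val_inj; rewrite /= inordK.
have neq_l1 x : ~~ leaf x -> x != l1 by apply: contraNneq => ->.
apply: (@antimagic_of_longest_path G l1 par w n.+1) => //.
- case=> [_|i]; first by rewrite w_h // hh0 /= (par_leaf _ _ ll0 hl0).
  by rewrite ltnS => le_in; rewrite w_h // par_h.
- move=> x xw; have lx : leaf x.
    apply: contraNT xw => /nonleafP[i le_in ->].
    by rewrite -w_h // mem_nth // size_w; lia.
  have /nonleafP[i le_in ->] := leaf_adj_spine conn ge3 lx (adj_leaf _ lx).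
  by rewrite index_h.
- move=> x xl1; have [/adj_leaf//|] := boolP (leaf x).
  case/nonleafP=> i le_in ->; rewrite par_h //.
  case: (ltnP i n) => lt_in; first by rewrite w_h // hh_adj ?eqxx //; lia.
  have -> : i = n by lia.
  by rewrite w_last hhn adj_sym.
(* An edge at a leaf is encoded by that leaf, except at [l1], where the last spine vertex encodes
   it. *)
- have half x y : leaf x -> adj x y ->
    (x != l1) && (par x == y) || (y != l1) && (par y == x).
    move=> lx xy; rewrite (par_leaf _ _ lx xy) eqxx andbT.
    case: eqP => //= xl1; rewrite neq_l1 ?(leaf_adj_spine conn ge3 lx) //=.
    have -> : y = hh n.
      by rewrite hhn; apply: leaf_neighbour_unique lx xy _; rewrite xl1.
    by rewrite par_h // w_last xl1.
  move=> x y xy; have [/half->//|nx] := boolP (leaf x).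
  have [ly|ny] := boolP (leaf y); first by rewrite orbC half // adj_sym.
  rewrite !neq_l1 //=; move: xy.
  have [i le_i ->] := nonleafP _ nx; have [j le_j ->] := nonleafP _ ny.
  rewrite hh_adj // => /orP[]/eqP e; [apply/orP; left|apply/orP; right].
    by rewrite par_h // e w_h // -e; lia.
  by rewrite par_h // e w_h.
- by rewrite subSS subn0.
Qed.

End Spine.

(* Subtraction on nat is truncated at 0, which renders max(0, _);
   n./2 is the floor of n / 2, and s >= 1 for every caterpillar. *)
Theorem theorem1 (C : sgraph) (s : nat) :
  caterpillar C -> #|spine C| = s ->
  antimagic C (maxn 0 ((s - 1)./2 - 1 - leaves_excess C)).
Proof.
case=> [[conn _] ge3 [n [h [h_inj h_spine h_adj]]]].
rewrite -h_spine card_imset // card_ord => <-.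
by apply: (antimagic_spine conn ge3 h_inj h_spine h_adj); lia.
Qed.
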